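(* Let $(\Omega,\mathcal{F},\mathbf{P})$ be a probability space. For every jointly measurable function $f:\Omega\times[0,1]\to\{a,b\}$ and every $\varepsilon\in(0,1)$, the function $\alpha_\varepsilon(f):\Omega\times[0,1]\to\{a,b\}$ constructed from $f$ and $\varepsilon$ as described in the context satisfies $$\mathbf{P}\Bigl(\mathrm{Leb}\bigl(\{t\in[0,1] : f(t)=\alpha_\varepsilon(f)(t)\}\bigr)\ge 1-2\varepsilon\Bigr)\ge 1-\varepsilon ,$$ where $f(t)$ and $\alpha_\varepsilon(f)(t)$ denote the random variables $\omega\mapsto f(\omega,t)$ and $\omega\mapsto\alpha_\varepsilon(f)(\omega,t)$.
   Context: $\mathrm{Leb}$ denotes Lebesgue measure on $\mathbb{R}$, and $f_\omega(t)=f(\omega,t)$. Construction of $\alpha_\varepsilon(f)$. Let $\Omega_1\subseteq\Omega$ be the set, of probability 1, of all $\omega$ for which the section $f_\omega:[0,1)\to\{a,b\}$ is measurable. Step 1 (sets $C_\omega$). For every $\omega\in\Omega_1$, take, by Lusin's theorem, a compact set $C_\omega\subseteq[0,1)$ such that $f_\omega$ is continuous on $C_\omega$ and $\mathrm{Leb}(C_\omega)>1-\varepsilon$. The compact set $C_\omega$ is taken to be a union of finitely many closed intervals, on each of which $f_\omega$ is constant. Step 2 (integers $n_\omega$). For every $\omega\in\Omega_1$, let $n_\omega\in\mathbb{N}$ be such that $$\frac{1}{2^{n_\omega}}\cdot\#\Bigl\{k\in\{0,1,\dots,2^{n_\omega}-1\} : \Bigl[\tfrac{k}{2^{n_\omega}},\tfrac{k+1}{2^{n_\omega}}\Bigr]\subseteq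 C_\omega\Bigr\}>1-2\varepsilon .$$ Step 3 (integer $n_*$). Let $n_*\in\mathbb{N}$ be sufficiently large that $\mathbf{P}\bigl(\Omega_1\cap\{n_\omega\le n_*\}\bigr)>1-\varepsilon$. Step 4 (partition). Let $K=2^{n_*+1}$, and for each $k\in\{0,1,\dots,2^{n_*}-1\}$ let $t_{2k}=\frac{k}{2^{n_*}}$ and $t_{2k+1}=\frac{k+\varepsilon}{2^{n_*}}$; also $t_K=1$. Step 5 (the function). The function $g=\alpha_\varepsilon(f)$, which depends on $f$ and is itself a random function, is defined for each $\omega$ and each $k\in\{0,1,\dots,2^{n_*}-1\}$ as follows. (i) On $[t_{2k},t_{2k+1})$, $g(\omega,\cdot)$ is defined arbitrarily (its value at $t=1$ is immaterial). (ii) On $[t_{2k+1},t_{2k+2})$, $g(\omega,\cdot)$ is constant, equal to the value of $f_\omega$ that is more common on $[t_{2k},t_{2k+1})$: for each $t\in[t_{2k+1},t_{2k+2})$, $g(\omega,t)=a$ if $\mathrm{Leb}(\{s\in[t_{2k},t_{2k+1}) : f_\omega(s)=a\})>\frac{\varepsilon}{2^{n_*+1}}$, and $g(\omega,t)=b$ otherwise.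
   Formalization: Proved for all sufficiently large n_*, not for every n_* with P(Ω₁∩{n_ω≤n_*})>1−ε (false: agreement can be 15/32<1/2 at ε=1/4). C_ω and measurable n_ω as in Steps 1–2 are taken as given; for some f (fat Cantor indicator) no such C_ω exists and α_ε(f) is undefined. *)

(* Defs.v *)
From HB Require Import structures.
From mathcomp Require Import all_boot all_order all_algebra.
From mathcomp Require Import all_classical all_reals all_analysis.

Set Implicit Arguments.
Unset Strict Implicit.
Unset Printing Implicit Defensive.

Import Order.TTheory GRing.Theory Num.Theory.
Import numFieldNormedType.Exports.

Local Open Scope classical_set_scope.
Local Open Scope ring_scope.

(* The two-point set {a, b} is bool, with a = true and b = false.  A function
   on Omega x [0,1] is represented by a function on T * R, of which only the
   values at points (w, t) with 0 <= t <= 1 matter. *)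

Section alpha.
Context {d : measure_display} {T : measurableType d} {R : realType}.
Implicit Types (f g : T * R -> bool) (eps : R) (w : T) (C : T -> set R).

Definition jointly_measurable f :=
  measurable_fun ([set: T] `*` (`[0, 1]%classic : set (measurableTypeR R)))
    (f : T * measurableTypeR R -> bool).

Definition Omega1 f : set T :=
  [set w | measurable_fun (`[0, 1[%classic : set (measurableTypeR R))
             (fun t : measurableTypeR R => f (w, t))].

Definition lusin_set f eps w (K : set R) : Prop :=
  [/\ compact K, K `<=` `[0, 1[%classic,
      {within K, continuous (fun t => f (w, t))},
      ((1 - eps)%:E < lebesgue_measure K)%E &
      exists s : seq (R * R),
        K = \bigcup_(I in [set` s]) `[I.1, I.2]%classic /\
        (forall I, I \in s ->
           exists c : bool, forall t, t \in `[I.1, I.2] -> f (w, t) = c)].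

Definition dyadic_cell (m k : nat) : set R :=
  `[k%:R / 2 ^+ m, k.+1%:R / 2 ^+ m]%classic.

Definition dyadic_fraction (K : set R) (m : nat) : R :=
  #|[pred k : 'I_(2 ^ m) | `[< dyadic_cell m k `<=` K >]]|%:R / 2 ^+ m.

(* t_(2k) = k / 2^m and t_(2k+1) = (k + eps) / 2^m; for k = 2^m the first
   formula gives the endpoint t_(2^(m+1)) = 1. *)
Definition tpart eps (m j : nat) : R :=
  (if odd j then j./2%:R + eps else j./2%:R) / 2 ^+ m.

(* g is a possible value of alpha_eps(f) when n_* = m.  Nothing at all, not
   even measurability, is required of g on the intervals [t_(2k), t_(2k+1)). *)
Definition is_alpha eps f (m : nat) g : Prop :=
  forall w (k : nat), (k < 2 ^ m)%N ->
  forall t : R, tpart eps m k.*2.+1 <= t < tpart eps m k.*2.+2 ->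
    g (w, t) =
      if ((eps / 2 ^+ m.+1)%:E <
          lebesgue_measure
            [set s : R | (tpart eps m k.*2 <= s < tpart eps m k.*2.+1)%R
                         /\ f (w, s) = true])%E
      then true else false.

Definition agreement f g w : set R :=
  [set t : R | 0 <= t <= 1 /\ f (w, t) = g (w, t)].

End alpha.

(* Since alpha_eps(f) is arbitrary on part of its domain, the sets measured in
   the conclusion need not be measurable.  The inner measure gives the least
   favourable value, and coincides with the measure on measurable sets. *)
Definition inner_measure {d} {T : measurableType d} {R : realType}
    (mu : {measure set T -> \bar R}) (A : set T) : \bar R :=
  ereal_sup [set mu B | B in [set B | measurable B /\ B `<=` A]].

Lemma inner_measureE {d} {T : measurableType d} {R : realType}
    (mu : {measure set T -> \bar R}) (A : set T) :
  measurable A -> inner_measure mu A = mu A.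
Proof.
move=> mA; apply/eqP; rewrite eq_le; apply/andP; split.
  apply: ge_ereal_sup => _ [B [mB BA] <-].
  by apply: le_measure; rewrite ?inE.
by apply: ereal_sup_ubound; exists A => //; split.
Qed.

(* Main.v *)
Require Import Defs.
From HB Require Import structures.
From mathcomp Require Import all_boot all_order all_algebra.
From mathcomp Require Import all_classical all_reals all_analysis.
From mathcomp Require Import ring lra.
Import Order.TTheory GRing.Theory Num.Theory.
Import numFieldNormedType.Exports.
Local Open Scope classical_set_scope.
Local Open Scope ring_scope.

(** Call a dyadic cell [k/2^m, (k+1)/2^m) constant for w when f(w, .) is
    constant on it.  On a constant cell the majority value over the early part
    [k/2^m, (k+eps)/2^m) is the right one, so alpha_eps(f) agrees with f on the
    whole late part [(k+eps)/2^m, (k+1)/2^m), which is a proportion 1 - eps of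
    the cell.  If the constant cells cover more than 1 - eps of [0, 1), the
    agreement set thus has measure more than (1 - eps)^2, which is at least
    1 - 2 eps ([faithful_ge]).

    Knowing n_w <= n_* only gives that the constant cells cover more than
    1 - 2 eps, hence an agreement of (1 - eps)(1 - 2 eps): too little.  What
    saves the bound is that n_* may be taken larger.  Up to finitely many
    endpoints, every point of the Lusin set C_w lies in a constant cell of
    level m for all large m; since Leb(C_w) > 1 - eps, the constant cells of
    level m cover more than 1 - eps for all large m
    ([eventually_constant_cells]).

    It remains to choose n_* uniformly in w, outside an event of probability
    less than eps.  As w |-> C_w carries no measurability, the event used is
    the one that the set [faithful], where f takes the early majority value of
    the current cell, has a section of measure at least 1 - 2 eps.  That set is
    jointly measurable, so the event is measurable by Fubini; every w belongs
    to it for all large m, so its probability eventually exceeds 1 - eps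
    ([measure_liminf_gt]).  The set [faithful] does not mention the arbitrary
    values of alpha_eps(f), and its sections lie in the agreement set of every
    admissible choice, which yields the bound on inner measures. *)

(** * Continuity from below along a liminf of sets *)

(** The tail intersections of the B m increase to a set containing V, so some
    tail intersection already has measure above c, and it lies in every later
    B m.  It serves both for P on the sample space and, for a fixed outcome,
    for Lebesgue measure on the unit interval. *)
Lemma measure_liminf_gt (R : realType) (d : measure_display)
    (T : measurableType d) (mu : {measure set T -> \bar R})
    (B : nat -> set T) (V : set T) (c : \bar R) :
  (forall m, measurable (B m)) -> measurable V ->
  (forall x, V x -> exists M, forall m, (M <= m)%N -> B m x) ->
  (c < mu V)%E ->
  exists M, forall m, (M <= m)%N -> (c < mu (B m))%E.
Proof.
move=> mB mV VB cV.
pose F M := \bigcap_(m in [set m | (M <= m)%N]) B m.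
have mF M : measurable (F M) by apply: bigcap_measurable => //; exists M => /=.
have mUF : measurable (\bigcup_M F M) by exact: bigcup_measurable.
have homoF : {homo F : p q / (p <= q)%N >-> (p <= q)%O}.
  move=> p q pq; apply/subsetPset => x Fpx m /= qm.
  by apply: Fpx => /=; exact: leq_trans qm.
have cvgF := nondecreasing_cvg_mu (mu := mu) mF mUF homoF.
have [M cM] : exists M, (c < mu (F M))%E.
  apply: contrapT => /forallNP noM.
  have : (mu (\bigcup_M F M) <= c)%E.
    rewrite -(cvg_lim _ cvgF)//; apply: lime_le.
      by apply/cvg_ex; eexists; exact: cvgF.
    by near=> M; rewrite leNgt; apply/negP; exact: noM.
  apply/negP; rewrite -ltNge; apply: lt_le_trans cV _.
  apply: le_measure; rewrite ?inE// => x /VB[M BM].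
  by exists M => // m /=; exact: BM.
exists M => m Mm; apply: lt_le_trans cM _.
by apply: le_measure; rewrite ?inE// => x; apply.
Unshelve. all: by end_near. Qed.

(** * Dyadic cells, their early parts and their late parts *)

Definition cell {R : realType} (m k : nat) : set R :=
  `[k%:R / 2 ^+ m, k.+1%:R / 2 ^+ m[%classic.

Definition early {R : realType} (eps : R) (m k : nat) : set R :=
  `[k%:R / 2 ^+ m, (k%:R + eps) / 2 ^+ m[%classic.

Definition late {R : realType} (eps : R) (m k : nat) : set R :=
  `[(k%:R + eps) / 2 ^+ m, k.+1%:R / 2 ^+ m[%classic.

Section pieces.
Context {R : realType}.
Implicit Types (eps t : R) (m k : nat).

Lemma exp2_gt0 m : 0 < 2 ^+ m :> R.
Proof. by rewrite exprn_gt0. Qed.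

Lemma tpart_early eps m k (s : R) :
  (tpart eps m k.*2 <= s < tpart eps m k.*2.+1) = (s \in early eps m k).
Proof.
by rewrite /tpart /early /= mem_setE in_itv/= odd_double/= uphalf_double doubleK.
Qed.

Lemma tpart_late eps m k (s : R) :
  (tpart eps m k.*2.+1 <= s < tpart eps m k.*2.+2) = (s \in late eps m k).
Proof.
by rewrite /tpart /late /= mem_setE in_itv/= odd_double/= uphalf_double doubleK.
Qed.

Lemma early_sub_cell eps m k : eps < 1 -> early eps m k `<=` cell m k.
Proof.
move=> e1 t; rewrite /early /cell /= !in_itv/= => /andP[-> /lt_le_trans]; apply.
by rewrite ler_pM2r ?invr_gt0 ?exp2_gt0// -natr1 lerD2l ltW.
Qed.

Lemma late_sub_cell eps m k : 0 < eps -> late eps m k `<=` cell m k.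
Proof.
move=> e0 t; rewrite /late /cell /= !in_itv/= => /andP[kt ->]; rewrite andbT.
apply: le_trans kt; rewrite ler_pM2r ?invr_gt0 ?exp2_gt0//.
by rewrite lerDl ltW.
Qed.

Lemma cell_sub_unit m k : (k < 2 ^ m)%N -> (cell m k : set R) `<=` `[0, 1[.
Proof.
move=> km t; rewrite /cell /= !in_itv/= => /andP[kt tk]; apply/andP; split.
  by apply: le_trans kt; rewrite divr_ge0 ?ler0n ?ltW ?exp2_gt0.
apply: (lt_le_trans tk); rewrite ler_pdivrMr ?exp2_gt0// mul1r.
by rewrite -natrX ler_nat.
Qed.

(** A point t of the cell k of level m has k = trunc (t 2^m). *)
Lemma trivIset_cell m (D : set nat) : trivIset D (fun k => cell m k : set R).
Proof.
move=> i j _ _ [t []]; rewrite /cell /= !in_itv/=.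
have p0 := exp2_gt0 m.
rewrite !ler_pdivrMr// !ltr_pdivlMr// => /andP[a b] /andP[c e].
have tm : 0 <= t * 2 ^+ m by apply: le_trans a; rewrite ler0n.
by rewrite -(@truncn_def _ (t * 2 ^+ m) i) ?a ?b// (@truncn_def _ _ j)// c e.
Qed.

Lemma lebesgue_cell m k : lebesgue_measure (cell m k : set R) = (2 ^- m)%:E.
Proof.
have p0 := exp2_gt0 m.
rewrite lebesgue_measure_itv/= lte_fin ltr_pM2r ?invr_gt0// ltr_nat ltnSn.
by rewrite -EFinD -mulrBl -natr1 addrAC subrr add0r mul1r.
Qed.

Lemma lebesgue_early eps m k : 0 < eps ->
  lebesgue_measure (early eps m k) = (eps / 2 ^+ m)%:E.
Proof.
move=> e0; have p0 := exp2_gt0 m.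
rewrite lebesgue_measure_itv/= lte_fin ltr_pM2r ?invr_gt0// ltrDl e0.
by rewrite -EFinD -mulrBl addrAC subrr add0r.
Qed.

Lemma lebesgue_late eps m k : eps < 1 ->
  lebesgue_measure (late eps m k) = ((1 - eps) / 2 ^+ m)%:E.
Proof.
move=> e1; have p0 := exp2_gt0 m.
rewrite lebesgue_measure_itv/= lte_fin ltr_pM2r ?invr_gt0// -natr1 ltrD2l e1.
by rewrite -EFinD -mulrBl; congr (_ / _)%:E; ring.
Qed.

(** The cell of level m around t has length 2^-m, hence fits in [a, b] as soon
    as 2^-m is below the distance from t to the endpoints. *)
Lemma near_cell (a b t : R) : 0 <= t < 1 -> a < t < b ->
  exists M, forall m, (M <= m)%N ->
    exists2 k, (k < 2 ^ m)%N & cell m k t /\ cell m k `<=` `[a, b].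
Proof.
move=> /andP[t0 t1] /andP[a_t tb].
have e0 : 0 < Num.min (t - a) (b - t) by rewrite lt_min !subr_gt0 a_t.
have [M _ HM] := near_infty_natSinv_expn_lt (PosNum e0).
exists M => m Mm; have := HM m Mm; rewrite /= lt_min div1r => /andP[ma mb].
have p0 := exp2_gt0 m.
have tm0 : 0 <= t * 2 ^+ m by rewrite mulr_ge0 // ltW.
have /andP[kt tk] := truncn_itv tm0.
set k := Num.truncn _ in kt tk; exists k.
  rewrite -(ltr_nat R) natrX; apply: (le_lt_trans kt).
  by rewrite -ltr_pdivlMr// divff// gt_eqF.
have kt' : k%:R / 2 ^+ m <= t by rewrite ler_pdivrMr.
have tk' : t < k.+1%:R / 2 ^+ m by rewrite ltr_pdivlMr.
have kS : k.+1%:R / 2 ^+ m = k%:R / 2 ^+ m + 2 ^- m :> R.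
  by rewrite -natr1 mulrDl mul1r.
split; first by rewrite /cell /= in_itv/= kt' tk'.
move=> s; rewrite /cell /= !in_itv/= => /andP[ks sk].
rewrite kS in sk tk'; apply/andP; split; lra.
Qed.

End pieces.

(** * The set where f follows the early majority *)

Definition majority {R : realType} {T : Type} (f : T * R -> bool) (eps : R)
    (m : nat) (w : T) (k : nat) : bool :=
  ((eps / 2 ^+ m.+1)%:E <
     lebesgue_measure [set s : R | s \in early eps m k /\ f (w, s) = true])%E.

(** A part of the agreement set that every version of alpha_eps(f) shares,
    as a subset of the product space so that Fubini applies to it. *)
Definition faithful {R : realType} {T : Type} (f : T * R -> bool) (eps : R)
    (m : nat) : set (T * R) :=
  \bigcup_(k in `I_(2 ^ m))
    [set p | p.2 \in late eps m k /\ f p = majority f eps m p.1 k].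

Definition constant_cells {R : realType} {T : Type} (f : T * R -> bool)
    (m : nat) (w : T) : set nat :=
  [set k | (k < 2 ^ m)%N /\
           exists c : bool, forall t, cell m k t -> f (w, t) = c].

Section random_function.
Context {d : measure_display} {T : measurableType d} {R : realType}.
Context (f : T * R -> bool) (eps : R).
Context (eps_gt0 : 0 < eps) (eps_lt1 : eps < 1).

(** If f(w, .) = c on the cell, the early part on which f(w, .) is true has
    measure eps/2^m or 0, on either side of the threshold eps/2^(m+1). *)
Lemma majority_constant m w k (c : bool) :
  (forall t, cell m k t -> f (w, t) = c) -> majority f eps m w k = c.
Proof.
move=> fc; rewrite /majority; have p0 := @exp2_gt0 R m.
case: c fc => fc.
  rewrite (_ : [set s | _] = early eps m k); last first.
    apply/seteqP; split=> s /= => [[/set_mem//]|es].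
    by split; [exact: mem_set | apply: fc; exact: early_sub_cell es].
  rewrite lebesgue_early// lte_fin ltr_pM2l// ltf_pV2 ?posrE ?exp2_gt0//.
  by rewrite exprS ltr_pMl ?ltr1n.
rewrite (_ : [set s | _] = set0); last first.
  rewrite -subset0 => s /= [/set_mem es].
  by rewrite fc//; exact: early_sub_cell es.
rewrite measure0; apply/negbTE; rewrite -leNgt lee_fin.
by rewrite divr_ge0// ltW// exp2_gt0.
Qed.

Lemma faithful_sub_agreement m g w : is_alpha eps f m g ->
  xsection (faithful f eps m) w `<=` agreement f g w.
Proof.
move=> gP t /xsectionP[k /= km [tk ft]].
have tk' : cell m k t by apply: late_sub_cell (set_mem tk).
have := cell_sub_unit _ _ km _ tk'; rewrite /= in_itv/= => /andP[t0 t1].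
split; first by rewrite t0 ltW.
rewrite (gP w k km t) ?tpart_late// ft /majority.
under eq_set do rewrite -tpart_early.
by case: ifP.
Qed.

Context (mf : jointly_measurable f).

(** Joint measurability of f is only assumed over the unit interval, whence the
    restriction on I. *)
Lemma measurable_level (I : set R) (b : bool) :
  measurable I -> I `<=` `[0, 1] ->
  measurable [set p : T * measurableTypeR R | p.2 \in I /\ f p = b].
Proof.
move=> mI I01.
have mT1 : measurable ([set: T] `*` (`[0, 1]%classic : set (measurableTypeR R))).
  by apply: measurableX => //; exact: measurable_itv.
have mTI : measurable ([set: T] `*` (I : set (measurableTypeR R))).
  exact: measurableX.
rewrite (_ : mkset _ = ([set: T] `*` I) `&`
    (([set: T] `*` `[0, 1]) `&` f @^-1` [set b])).
  by apply: measurableI => //; exact: mf.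
apply/seteqP; split=> [[w t] /= [/set_mem It ft]|[w t] /= [[_ It] [_ ft]]].
  by do !split => //; exact: I01.
by split => //; exact: mem_set.
Qed.

Lemma Omega1T : Omega1 f = setT.
Proof.
apply/seteqP; split=> // w _; apply: (measurable_fun_bool true).
rewrite (_ : _ `&` _ =
  xsection [set p : T * measurableTypeR R |
              p.2 \in (`[0, 1[%classic : set R) /\ f p = true] w).
  apply: measurable_xsection; apply: measurable_level => //.
  by move=> t /=; rewrite !in_itv/= => /andP[-> /ltW].
by rewrite xsectionE; apply/seteqP; split=> t /= [] => [/mem_set|/set_mem].
Qed.

Lemma early_sub_unit m k : (k < 2 ^ m)%N -> early eps m k `<=` `[0, 1].
Proof.
move=> km t /(early_sub_cell _ _ _ eps_lt1)/(cell_sub_unit _ _ km) /=.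
by rewrite !in_itv/= => /andP[-> /ltW].
Qed.

Lemma late_sub_unit m k : (k < 2 ^ m)%N -> late eps m k `<=` `[0, 1].
Proof.
move=> km t /(late_sub_cell _ _ _ eps_gt0)/(cell_sub_unit _ _ km) /=.
by rewrite !in_itv/= => /andP[-> /ltW].
Qed.

Lemma measurable_majority m k : (k < 2 ^ m)%N ->
  measurable [set w | majority f eps m w k].
Proof.
move=> km.
set A := [set p : T * measurableTypeR R | p.2 \in early eps m k /\ f p = true].
have mA : measurable A.
  by apply: measurable_level; [exact: measurable_itv | exact: early_sub_unit].
have := measurable_fun_xsection (@lebesgue_measure R) mA.
move=> /(measurable_realfun.emeasurable_fun_o_infty measurableT) /(_ (eps / 2 ^+ m.+1)%:E).
rewrite setTI; congr measurable; apply/seteqP.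
by split=> w; rewrite /= /majority xsectionE.
Qed.

Lemma measurable_faithful m :
  measurable (faithful f eps m : set (T * measurableTypeR R)).
Proof.
apply: fin_bigcup_measurable => [|k /= km]; first exact: finite_II.
have mM := measurable_majority _ _ km.
have mL b : measurable
    [set p : T * measurableTypeR R | p.2 \in late eps m k /\ f p = b].
  by apply: measurable_level; [exact: measurable_itv | exact: late_sub_unit].
have mMX : measurable
    ([set w | majority f eps m w k] `*` [set: measurableTypeR R]).
  exact: measurableX.
(* Splitting according to the value of the majority separates w from t. *)
rewrite (_ : mkset _ =
    ([set w | majority f eps m w k] `*` setT) `&`
      [set p | p.2 \in late eps m k /\ f p = true] `|`
    ~` ([set w | majority f eps m w k] `*` setT) `&`
      [set p | p.2 \in late eps m k /\ f p = false]).
  by apply: measurableU; apply: measurableI => //; exact: measurableC.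
apply/seteqP; split => [[w t] /= [tk ->]|[w t] /=].
  by case: majority; [left|right]; do !split => //; case.
move=> [[[-> _] [tk ->]]//|[nM [tk ->]]]; split => //.
by apply/esym/negP => Mw; exact: nM.
Qed.

Lemma measurable_cells m (D : set nat) :
  measurable (\bigcup_(k in D) (cell m k : set (measurableTypeR R))).
Proof. by apply: bigcup_measurable => k _; exact: measurable_itv. Qed.

(** Cell by cell, the late part of a constant cell lies in the faithful set and
    has 1 - eps times the measure of the cell; the late parts are disjoint. *)
Lemma faithful_ge m w :
  ((1 - eps)%:E *
     lebesgue_measure (\bigcup_(k in constant_cells f m w) (cell m k : set R)) <=
   lebesgue_measure (xsection (faithful f eps m) w))%E.
Proof.
set D := constant_cells f m w.
have finD : finite_set D.
  by apply: sub_finite_set (finite_II (2 ^ m)) => k [].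
have mJ k : measurable (late eps m k : set (measurableTypeR R)).
  exact: measurable_itv.
have tJ : trivIset D (late eps m).
  move=> i j Di Dj [t [it jt]]; apply: (@trivIset_cell R m D) => //.
  by exists t; split; apply: late_sub_cell _ _ _ eps_gt0 _ _.
rewrite (@measure_fin_bigcup _ _ _ lebesgue_measure)//; last 2 first.
- exact: trivIset_cell.
- by move=> k _; exact: measurable_itv.
rewrite ge0_mule_fsumr//.
rewrite (eq_fsbigr (fun k => lebesgue_measure (late eps m k))); last first.
  move=> k _; transitivity ((1 - eps)%:E * (2 ^- m)%:E)%E.
    by congr (_ * _)%E; exact: lebesgue_cell.
  by rewrite -EFinM; exact/esym/lebesgue_late.
rewrite -measure_fin_bigcup//.
apply: le_measure; rewrite ?inE.
- exact: bigcup_measurable.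
- exact: measurable_xsection (measurable_faithful m).
move=> t [k [km [c fc]] kt]; apply/xsectionP; exists k => //=.
split; first exact: mem_set.
by rewrite (majority_constant _ _ _ _ fc); apply: fc; exact: late_sub_cell kt.
Qed.

(** Removing the endpoints of its intervals, a null set, leaves of the Lusin
    set an open set V.  A point of V has its cell of level m inside one of the
    intervals for all large m, and f(w, .) is constant there. *)
Lemma eventually_constant_cells w K : lusin_set f eps w K ->
  exists M, forall m, (M <= m)%N ->
    ((1 - eps)%:E < lebesgue_measure
       (\bigcup_(k in constant_cells f m w) (cell m k : set R)))%E.
Proof.
case=> _ K01 _ muK [s [KE fs]].
pose V : set (measurableTypeR R) := \bigcup_(I in [set` s]) `]I.1, I.2[%classic.
pose E := [set I.1 | I in [set` s]] `|` [set I.2 | I in [set` s]].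
have mV : measurable V.
  by apply: fin_bigcup_measurable => [|I _]; [exact: finite_seq|exact: measurable_itv].
have finE : finite_set E.
  by rewrite finite_setU; split; apply: finite_image; exact: finite_seq.
have cE : countable E := finite_set_countable finE.
have mE : measurable (E : set (measurableTypeR R)) by exact: countable_measurable.
have mK : measurable (K : set (measurableTypeR R)).
  rewrite KE; apply: fin_bigcup_measurable => [|I _].
    exact: finite_seq.
  exact: measurable_itv.
apply: (@measure_liminf_gt _ _ _ lebesgue_measure _ V).
- by move=> m; exact: measurable_cells.
- exact: mV.
- move=> t [I Is tI]; rewrite /= in_itv/= in tI.
  have Kt : K t.
    rewrite KE; exists I => //=; rewrite in_itv/=.
    by case/andP: tI => /ltW -> /ltW ->.
  have := K01 _ Kt; rewrite /= in_itv/= => t01.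
  have [M HM] := near_cell _ _ _ t01 tI; exists M => m /HM[k km [kt kI]].
  exists k => //; split => //.
  by have [c fc] := fs I Is; exists c => u /kI; exact: fc.
- apply: (lt_le_trans muK).
  rewrite -(@measureU0 _ _ _ lebesgue_measure V E)//; last first.
    exact: countable_lebesgue_measure0.
  apply: le_measure; rewrite ?inE//; first exact: measurableU.
  rewrite KE => t [I Is /=]; rewrite in_itv/= => /andP[].
  rewrite le_eqVlt => /predU1P[<-|It]; first by right; left; exists I.
  rewrite le_eqVlt => /predU1P[->|tI]; first by right; right; exists I.
  by left; exists I => //=; rewrite in_itv/= It tI.
Qed.

(** The constant 1 - 2 eps comes from (1 - eps)^2 = 1 - 2 eps + eps^2. *)
Lemma eventually_faithful w K : lusin_set f eps w K ->
  exists M, forall m, (M <= m)%N ->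
    ((1 - 2 * eps)%:E <= lebesgue_measure (xsection (faithful f eps m) w))%E.
Proof.
move=> /eventually_constant_cells[M HM]; exists M => m /HM cm.
apply: le_trans (faithful_ge m w).
apply: (@le_trans _ _ ((1 - eps)%:E * (1 - eps)%:E)%E).
  by rewrite -EFinM lee_fin; nra.
by rewrite lee_pmul2l// ?lte_fin ?subr_gt0// ltW.
Qed.

End random_function.

(** * Choice of the level *)

Lemma inner_measure_ge {d : measure_display} {T : measurableType d}
    {R : realType} (mu : {measure set T -> \bar R}) (A B : set T) :
  measurable B -> B `<=` A -> (mu B <= inner_measure mu A)%E.
Proof. by move=> mB BA; apply: ereal_sup_ubound; exists B. Qed.

Theorem proposition2p1 (R : realType) (d : measure_display)
    (T : measurableType d) (P : probability T R)
    (f : T * R -> bool) (mf : jointly_measurable f)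
    (eps : R) (eps_gt0 : 0 < eps) (eps_lt1 : eps < 1)
    (C : T -> set R)
    (hC : forall w, Omega1 f w -> lusin_set f eps w (C w))
    (n : T -> nat) (mn : measurable_fun (Omega1 f) n)
    (hn : forall w, Omega1 f w ->
            1 - 2 * eps < dyadic_fraction (C w) (n w)) :
  exists N : nat, forall nstar : nat, (N <= nstar)%N ->
    ((1 - eps)%:E < P (Omega1 f `&` [set w | (n w <= nstar)%N]))%E /\
    forall g : T * R -> bool, is_alpha eps f nstar g ->
      ((1 - eps)%:E <=
        inner_measure P
          [set w | ((1 - 2 * eps)%:E <=
                    inner_measure lebesgue_measure (agreement f g w))%E])%E.
Proof.
have PT : ((1 - eps)%:E < P setT)%E.
  by rewrite probability_setT lte_fin ltrBlDr ltrDl.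
(* Sections of a jointly measurable function are all measurable. *)
rewrite (Omega1T _ mf) in hC mn hn *.
pose A m := [set w |
  ((1 - 2 * eps)%:E <= lebesgue_measure (xsection (faithful f eps m) w))%E].
have mA m : measurable (A m).
  have := measurable_fun_xsection (@lebesgue_measure R)
    (measurable_faithful _ _ eps_gt0 eps_lt1 mf m).
  move=> /(measurable_realfun.emeasurable_fun_c_infty measurableT) /(_ (1 - 2 * eps)%:E).
  by rewrite setTI.
have [N1 HN1] : exists M, forall m, (M <= m)%N ->
    ((1 - eps)%:E < P (setT `&` [set w | (n w <= m)%N]))%E.
  apply: (@measure_liminf_gt _ _ _ P _ setT) => // [m|w _].
    exact: (mn measurableT [set k | (k <= m)%N]).
  by exists (n w).
have [N2 HN2] : exists M, forall m, (M <= m)%N -> ((1 - eps)%:E < P (A m))%E.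
  apply: (@measure_liminf_gt _ _ _ P _ setT) => // w _.
  exact: (eventually_faithful _ _ eps_gt0 eps_lt1 mf _ _ (hC w I)).
exists (maxn N1 N2) => m; rewrite geq_max => /andP[/HN1 ? /HN2 PA].
split=> // g galpha; apply: (le_trans (ltW PA)).
apply: inner_measure_ge => // w /= Aw; apply: (le_trans Aw).
apply: inner_measure_ge; first
  exact: measurable_xsection (measurable_faithful _ _ eps_gt0 eps_lt1 mf m).
exact: faithful_sub_agreement galpha.
Qed.
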